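(* For each $\boldsymbol{p}=(t,x,\dot x,p_t,p_x,p_{\dot x})\in\mathscr{J}_{\mathrm{diff}}^{-1}(0)\subset T^*J_0^1$, the orbit of the Lie algebra $\mathrm{diff}_+\mathbf{R}$ through $\boldsymbol{p}$ and the orbit of the reparametrization group $\mathrm{Diff}_+\mathbf{R}$ through $\boldsymbol{p}$ both coincide with $$O_{\boldsymbol{p}}=\{(u,x,e^s\dot x,p_t,p_x,e^{-s}p_{\dot x})\mid(u,s)\in\mathbf{R}^2\},$$ where $p_t=0$; this is the integral manifold through $\boldsymbol{p}$ of the distribution spanned by the Hamiltonian vector fields $X_{p_t}$ and $X_{\langle p_{\dot x},\dot x\rangle}$.
   Context: $J_0^1=\{(t,x,\dot x)\in\mathbf{R}\times\mathbf{R}^3\times\mathbf{R}^3\mid\dot x\ne0\}$, and $T^*J_0^1$ has coordinates $(t,x,\dot x,p_t,p_x,p_{\dot x})$ and canonical symplectic form $\omega=dp_t\wedge dt+dp_x\wedge dx+dp_{\dot x}\wedge d\dot x$. For a smooth function $f$ on $T^*J_0^1$, its Hamiltonian vector field $X_f$ is defined by: the contraction of $X_f$ with $\omega$ equals $-df$. $\mathrm{Diff}_+\mathbf{R}$ is the group of orientation preserving diffeomorphisms of $\mathbf{R}$ (so $\dot\varphi>0$). It acts on $J_0^1$ by $(\varphi,(t,x,\dot x))\mapsto(\varphi(t),x,\dot x/\dot\varphi(t))$, and on $T^*J_0^1$ by the lifted action $$(\varphi,(t,x,\dot x,p_t,p_x,p_{\dot x}))\mapsto\left(\varphi(t),x,\frac{\dot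 x}{\dot\varphi(t)},\frac{p_t}{\dot\varphi(t)}+\frac{\langle p_{\dot x},\dot x\rangle\ddot\varphi(t)}{\dot\varphi(t)^2},p_x,\dot\varphi(t)p_{\dot x}\right).$$ The paper takes $\mathrm{diff}_+\mathbf{R}=\{\tau(t)\partial_t\mid\tau\in C^\infty(\mathbf{R}),\ \dot\tau(t)\neq0\text{ for all }t\}$. The lifted action of the one-parameter group generated by $\tau\partial_t$ is generated by the Hamiltonian vector field $X_{\mathscr{J}_\tau}$ of $\mathscr{J}_\tau=\tau(t)p_t-\dot\tau(t)\langle p_{\dot x},\dot x\rangle$. The map $\mathscr{J}_{\mathrm{diff}}:\tau\partial_t\mapsto\mathscr{J}_\tau$ is regarded as the momentum map, and $\mathscr{J}_{\mathrm{diff}}^{-1}(0)$ is its zero level, namely $\{p_t=0,\ \langle p_{\dot x},\dot x\rangle=0\}$. The orbit of the Lie algebra $\mathrm{diff}_+\mathbf{R}$ through a point is the orbit (accessible set) through that point of the family of vector fields $\{X_{\mathscr{J}_\tau}\mid\tau\partial_t\in\mathrm{diff}_+\mathbf{R}\}$ on $T^*J_0^1$. *)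

(* Defs.v *)
From HB Require Import structures.
From mathcomp Require Import all_boot all_order all_algebra.
From mathcomp Require Import all_classical all_reals all_analysis.

Set Implicit Arguments.
Unset Strict Implicit.
Unset Printing Implicit Defensive.

Import Order.TTheory GRing.Theory Num.Theory.
Import numFieldNormedType.Exports.

Local Open Scope classical_set_scope.
Local Open Scope ring_scope.

Section smooth_maps.
Variables (R : realType) (V W : normedModType R).

Fixpoint iter_derive (f : V -> W) (vs : seq V) : V -> W :=
  if vs is v :: vs' then iter_derive (fun x => 'D_v f x) vs' else f.

(* C^oo on an open set U; the values of f outside U are irrelevant. In finite
   dimension, existence and continuity of all iterated directional derivatives
   is the usual notion. *)
Definition smooth_on (U : set V) (f : V -> W) : Prop :=
  forall (vs : seq V) (x : V), U x ->
    {for x, continuous (iter_derive f vs)} /\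
    (forall v, derivable (iter_derive f vs) x v).

End smooth_maps.

Section immersed_submanifolds.
Variables (R : realType) (E : normedModType R) (k : nat).

(* A local parametrization (U, phi) : phi is only meaningful on U. *)
Definition param : Type := (set 'rV[R]_k * ('rV[R]_k -> E))%type.

Definition immersive_param (c : param) : Prop :=
  [/\ open c.1, smooth_on c.1 c.2, set_inj c.1 c.2
    & forall u, c.1 u -> injective ('d (c.2) u)].

(* The points of the domain of c that lie in the image of c'. *)
Definition overlap (c c' : param) : set 'rV[R]_k :=
  c.1 `&` c.2 @^-1` (c'.2 @` c'.1).

Definition compatible_params (c c' : param) : Prop :=
  open (overlap c c') /\
  exists g : 'rV[R]_k -> 'rV[R]_k, smooth_on (overlap c c') g /\
    forall u, overlap c c' u -> c'.1 (g u) /\ c'.2 (g u) = c.2 u.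

(* The subset N of E, with the topology and smooth structure given by the
   atlas A (not the subspace topology of E), is a k-dimensional immersed
   submanifold. Hausdorffness is automatic since N injects continuously
   into E. *)
Definition immersed_submanifold (N : set E) (A : set param) : Prop :=
  [/\ countable A,
      N = \bigcup_(c in A) (c.2 @` c.1),
      forall c, A c -> immersive_param c
    & forall c c', A c -> A c' -> compatible_params c c'].

Definition atlas_open (A : set param) (B : set E) : Prop :=
  forall c, A c -> open (c.1 `&` c.2 @^-1` B).

Definition atlas_connected (N : set E) (A : set param) : Prop :=
  forall B, B `<=` N -> B !=set0 ->
    atlas_open A B -> atlas_open A (N `\` B) -> B = N.

(* D q is the value at q of a distribution on the open subset M of E. *)
Definition connected_integral_manifold (M : set E) (D : E -> set E)
    (N : set E) : Prop :=
  N `<=` M /\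
  exists A : set param,
    [/\ immersed_submanifold N A, atlas_connected N A
      & forall c u, A c -> c.1 u -> range ('d (c.2) u) = D (c.2 u)].

(* The integral manifold through p, i.e. the leaf: the largest connected one. *)
Definition maximal_integral_manifold (M : set E) (D : E -> set E) (p : E)
    (N : set E) : Prop :=
  [/\ connected_integral_manifold M D N, N p
    & forall N', connected_integral_manifold M D N' -> N' p -> N' `<=` N].

End immersed_submanifolds.

Section vector_fields.
Variables (R : realType) (E : normedModType R) (M : set E).

Definition integral_curve (X : E -> E) (a b : R) (c : R -> E) : Prop :=
  forall r, a < r < b -> M (c r) /\ is_derive r 1 c (X (c r)).

(* The accessible set of a family F of vector fields on M: r2 may be smaller
   than r1, so that integral curves are followed in both directions. *)
Inductive vf_orbit (F : set (E -> E)) (p : E) : E -> Prop :=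
| vf_orbit_refl : M p -> vf_orbit F p p
| vf_orbit_step (X : E -> E) (a b r1 r2 : R) (c : R -> E) :
    F X -> integral_curve X a b c -> a < r1 < b -> a < r2 < b ->
    vf_orbit F p (c r1) -> vf_orbit F p (c r2).

Definition span2 (X Y : E -> E) (q : E) : set E :=
  [set w | exists a b : R, w = a *: X q + b *: Y q].

End vector_fields.

Section phase_space.
Variable R : realType.

(* (t, x, xdot) resp. (p_t, p_x, p_xdot). *)
Notation triple := (R * 'rV[R]_3 * 'rV[R]_3)%type.

(* ((t, x, xdot), (p_t, p_x, p_xdot)). T^*J_0^1 is the open subset TJ01 of this
   vector space, which is also identified with each of its tangent spaces. *)
Definition phase : normedModType R := (triple * triple)%type.

Definition c_t (z : phase) : R := z.1.1.1.
Definition c_x (z : phase) : 'rV[R]_3 := z.1.1.2.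
Definition c_xdot (z : phase) : 'rV[R]_3 := z.1.2.
Definition p_t (z : phase) : R := z.2.1.1.
Definition p_x (z : phase) : 'rV[R]_3 := z.2.1.2.
Definition p_xdot (z : phase) : 'rV[R]_3 := z.2.2.

Definition TJ01 : set phase := [set z | c_xdot z != 0].

Definition pairing (p v : 'rV[R]_3) : R := \sum_(i < 3) p 0 i * v 0 i.

(* omega = dp_t /\ dt + dp_x /\ dx + dp_xdot /\ dxdot, with
   (a /\ b) (v, w) = a v * b w - a w * b v. *)
Definition omega (v w : phase) : R :=
  (p_t v * c_t w - p_t w * c_t v)
  + (pairing (p_x v) (c_x w) - pairing (p_x w) (c_x v))
  + (pairing (p_xdot v) (c_xdot w) - pairing (p_xdot w) (c_xdot v)).

(* The vector X with omega (X, .) = - df at z; it exists and is unique since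
   omega is nondegenerate, so the default value 0 is never used. *)
Definition hamiltonian_vf (f : phase -> R) (z : phase) : phase :=
  xget 0 [set X | forall w, omega X w = - 'd f z w].

Definition Diff_plus (phi : R -> R) : Prop :=
  [/\ smooth_on setT phi,
      exists psi, [/\ cancel phi psi, cancel psi phi & smooth_on setT psi]
    & forall t, 0 < derive1 phi t].

Definition lifted_action (phi : R -> R) (z : phase) : phase :=
  ((phi (c_t z), c_x z, (derive1 phi (c_t z))^-1 *: c_xdot z),
   (p_t z / derive1 phi (c_t z)
      + pairing (p_xdot z) (c_xdot z) * derive1n 2 phi (c_t z) / derive1 phi (c_t z) ^+ 2,
    p_x z,
    derive1 phi (c_t z) *: p_xdot z)).

Definition group_orbit (z : phase) : set phase :=
  [set w | exists2 phi, Diff_plus phi & w = lifted_action phi z].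

(* tau represents the vector field tau(t) d/dt. *)
Definition diff_plus (tau : R -> R) : Prop :=
  smooth_on setT tau /\ forall t, derive1 tau t != 0.

Definition xdot_momentum (z : phase) : R := pairing (p_xdot z) (c_xdot z).

Definition J_ (tau : R -> R) (z : phase) : R :=
  tau (c_t z) * p_t z - derive1 tau (c_t z) * xdot_momentum z.

Definition J_diff_zero_level : set phase :=
  [set z | TJ01 z /\ forall tau, diff_plus tau -> J_ tau z = 0].

Definition algebra_orbit (z : phase) : set phase :=
  vf_orbit TJ01 [set X | exists2 tau, diff_plus tau & X = hamiltonian_vf (J_ tau)] z.

Definition O_ (z : phase) : set phase :=
  [set w | exists u s : R,
    w = ((u, c_x z, expR s *: c_xdot z), (p_t z, p_x z, expR (- s) *: p_xdot z))].

End phase_space.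

(* Main.v *)
Require Import Defs.
From HB Require Import structures.
From mathcomp Require Import all_boot all_order all_algebra.
From mathcomp Require Import all_classical all_reals all_analysis.
From mathcomp Require Import ring lra.
Import Order.TTheory GRing.Theory Num.Theory.
Import numFieldNormedType.Exports.
Local Open Scope classical_set_scope.
Local Open Scope ring_scope.

Set Implicit Arguments.
Unset Strict Implicit.
Unset Printing Implicit Defensive.

(** Let m be the function <p_xdot, xdot>. Evaluating J_tau at p for the affine
    functions tau(t) = t + b, b arbitrary, shows that the zero level is
    {p_t = 0, m = 0}.

    All three descriptions of O_p rest on one computation. The vector field
    X_{J_tau} is
      tau(t) d/dt - tau'(t) xdot d/dxdot + tau'(t) p_xdot d/dp_xdot
        + (tau''(t) m - tau'(t) p_t) d/dp_t,
    and the distribution is spanned by d/dt and xdot d/dxdot - p_xdot d/dp_xdot.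
    So the velocity of a curve in either setting has components alpha along t,
    beta xdot along xdot and - beta p_xdot along p_xdot, where alpha and beta
    are functions of the parameter about which nothing is known, not even
    continuity. Nevertheless beta has the primitive l = ln |xdot|, since
    (|xdot|^2)' = 2 beta |xdot|^2 and xdot is nonzero on phase space
    ([half_log_norm]). Hence e^{-l} xdot and e^{l} p_xdot are constant, and, as
    soon as p_t is constant, the curve stays in the set O of any of its points
    ([leaf_curve_in_O_]). For X_{J_tau} started on the zero level, m is constant
    because its derivative is (- beta + beta) m, so m = 0; then
    p_t' = beta p_t, and e^{-l} p_t is constant, so p_t remains 0.

    Conversely, affine functions are enough to fill O_p. The flow of
    tau(t) = - s (t + K) multiplies xdot by e^s in unit time, and for s <> 0 the
    constant K can be chosen to bring t to any prescribed value; s = 0 is reached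
    in two steps, with s = 1 and s = -1. Likewise an affine diffeomorphism with
    slope e^{-s} reaches each point of O_p in the group orbit; in the other
    direction, on the zero level the lifted action of phi only replaces t by
    phi(t) and rescales xdot and p_xdot by inverse factors.

    For the integral manifold, (u, s) |-> (u, x, e^s xdot, p_t, p_x,
    e^{-s} p_xdot) is one global chart of O_p, and the tangency of O_p to the
    distribution is read off its differential. For maximality, let N be a
    connected integral manifold through p. The image under a chart of N of a
    segment is a curve tangent to the distribution, so the points of N near any
    q in N, in the topology of the charts, lie in O_q
    ([tangent_param_locally_in_O_]). As the sets O are the classes of an
    equivalence relation, the intersection of N with O_p is both open and closed
    in N, hence it is N. *)

(** * Differentials, and scalar equations on an open interval *)

Section differentials.
Variables (R : realType).
Implicit Types (U V W : normedModType R).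

Lemma is_diff_linear V W (f : {linear V -> W}) x : continuous f -> is_diff x f f.
Proof.
move=> fcont; apply: DiffDef; first exact: linear_differentiable.
exact: diff_lin.
Qed.

Lemma is_diff_fst U V W (f df : U -> (V * W)%type) x :
  is_diff x f df -> is_diff x (fun y => (f y).1) (fun h => (df h).1).
Proof.
move=> fd; have ? : is_diff (f x) (@fst V W) fst.
  by apply: (@is_diff_linear (V * W)%type V fst) => y; exact: cvg_fst.
exact: (is_diff_comp fd).
Qed.

Lemma is_diff_snd U V W (f df : U -> (V * W)%type) x :
  is_diff x f df -> is_diff x (fun y => (f y).2) (fun h => (df h).2).
Proof.
move=> fd; have ? : is_diff (f x) (@snd V W) snd.
  by apply: (@is_diff_linear (V * W)%type W snd) => y; exact: cvg_snd.
exact: (is_diff_comp fd).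
Qed.

Lemma is_diff_entry m n U (f df : U -> 'M[R]_(m, n)) x i j :
  is_diff x f df -> is_diff x (fun y => f y i j) (fun h => df h i j).
Proof.
move=> fd; pose e := fun M : 'M[R]_(m, n) => M i j.
have eL : linear e by move=> a M N; rewrite /e !mxE.
pose eM := GRing.isLinear.Build _ _ _ _ _ eL.
pose eF : {linear 'M[R]_(m, n) -> R} := HB.pack e eM.
have ? : is_diff (f x) e e.
  by apply: (@is_diff_linear _ _ eF); exact: coord_continuous.
exact: (is_diff_comp fd).
Qed.

Lemma is_diff_pairing U (f df g dg : U -> 'rV[R]_3) x :
  is_diff x f df -> is_diff x g dg ->
  is_diff x (fun y => pairing (f y) (g y))
    (fun h => pairing (df h) (g x) + pairing (f x) (dg h)).
Proof.
move=> fd gd.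
have fi i := is_diff_entry 0 i fd.
have gi i := is_diff_entry 0 i gd.
rewrite /pairing; under eq_fun do rewrite !big_ord_recl big_ord0 addr0.
apply: is_diff_eq; rewrite funeqE => h.
by rewrite !big_ord_recl !big_ord0 /= !fctE /GRing.scale /=; ring.
Qed.

Lemma is_diff_scalel_comp U V (f df : U -> R) (v : V) x :
  is_diff x f df -> is_diff x (fun y => f y *: v) (fun h => df h *: v).
Proof.
by move=> fd; have ? := is_diff_scalel (f x) v; exact: (is_diff_comp fd).
Qed.

Lemma is_derive1_is_diff V (f : R -> V) (r : R) v :
  is_derive r (1 : R) f v -> is_diff r f (fun h => h *: v).
Proof.
move=> fv; have fd : derivable f r 1 by [].
apply: DiffDef; first exact/derivable1_diffP.
by rewrite deriv1E // derive1E derive_val.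
Qed.

Lemma is_diff_is_derive U V (f df : U -> V) x v :
  is_diff x f df -> is_derive x v f (df v).
Proof.
move=> fd; apply: DeriveDef; first exact: diff_derivable.
by rewrite deriveE // diff_val.
Qed.

(** This turns directional derivatives of a parametrization into velocities of
    the images of segments. *)
Lemma is_derive_line U V (f : U -> V) u h (r : R) v :
  is_derive (u + r *: h) h f v -> is_derive r (1 : R) (fun s => f (u + s *: h)) v.
Proof.
have E : (fun t : R => t^-1 *: (f (u + (t *: (1 : R) + r) *: h) - f (u + r *: h)))
       = (fun t : R => t^-1 *: (f (t *: h + (u + r *: h)) - f (u + r *: h))).
  rewrite funeqE => t; congr (_ *: (f _ - _)).
  by rewrite [t *: _]mulr1 scalerDl addrCA.
by case=> fd fv; apply: DeriveDef; rewrite /derivable /derive /= E.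
Qed.

(** ['d f x] is chosen among the continuous linear first-order approximations of
    f at x, with the zero map as default. Hence a map with injective ['d] on a
    nonzero space is differentiable, which spares deriving differentiability of a
    parametrization from the continuity of its partial derivatives. *)
Lemma diff_not_differentiable V W (f : V -> W) x :
  ~ differentiable f x -> 'd f x = \0 :> (V -> W).
Proof.
move=> nd; rewrite /diff xgetPN // => df dfP.
apply/nd/diffP; rewrite /diff.
exact: (@xgetI _ point
  (fun d : {linear V -> W} => continuous d /\ forall y, _) df dfP).
Qed.

Lemma is_derive_0_itvoo (a b : R) (f : R -> R) :
  (forall r, a < r < b -> is_derive r (1 : R) f 0) ->
  forall r1 r2, a < r1 < b -> a < r2 < b -> f r1 = f r2.
Proof.
move=> fd r1 r2.
wlog le12 : r1 r2 / r1 <= r2.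
  by move=> H; case: (leP r1 r2) => [/H//|/ltW/H h ? ?]; apply/esym/h.
move=> /andP[ar1 r1b] /andP[ar2 r2b].
have mem r : r1 <= r <= r2 -> a < r < b.
  by case/andP=> r1r rr2; rewrite (lt_le_trans ar1 r1r) (le_lt_trans rr2 r2b).
have [r | | c _] := @MVT_segment R f (fun=> 0) r1 r2 le12.
- by rewrite in_itv /= => /andP[r1r rr2]; apply: fd; apply: mem; rewrite !ltW.
- apply: derivable_within_continuous => r; rewrite in_itv /= => /mem/fd rd.
  by have [] := rd.
- by rewrite mul0r => /eqP; rewrite subr_eq0 => /eqP.
Qed.

(** e^{- k l} f has derivative zero. The coefficient is given by a primitive l
    because the coefficients to which this is applied are not known to be
    continuous. *)
Lemma linear_ode_expR (a b k : R) (f l dl : R -> R) :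
  (forall r, a < r < b -> is_derive r (1 : R) l (dl r)) ->
  (forall r, a < r < b -> is_derive r (1 : R) f (k * dl r * f r)) ->
  forall r1 r2, a < r1 < b -> a < r2 < b ->
  f r2 = expR (k * (l r2 - l r1)) * f r1.
Proof.
move=> ld fd r1 r2 r1ab r2ab.
pose g := fun r => expR (- (k * l r)) * f r.
have g12 : g r1 = g r2.
  apply: (@is_derive_0_itvoo a b) => // r rab.
  have ldr := ld r rab; have fdr := fd r rab.
  by rewrite /g; apply: is_derive_eq; rewrite /GRing.scale /=; ring.
have -> : k * (l r2 - l r1) = k * l r2 - k * l r1 by ring.
rewrite expRD -mulrA [expR (- _) * _]g12 /g mulrA -expRD.
by rewrite subrr expR0 mul1r.
Qed.
End differentials.

(** * Curves whose velocity rescales xdot and p_xdot inversely *)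

Section phase_curves.
Variable R : realType.
Implicit Types (z w : phase R).

Lemma is_diff_c_t z : is_diff z (@c_t R) (@c_t R).
Proof. by do 3! apply: is_diff_fst; exact: is_diff_id. Qed.

Lemma is_diff_c_x z : is_diff z (@c_x R) (@c_x R).
Proof. by apply: is_diff_snd; do 2! apply: is_diff_fst; exact: is_diff_id. Qed.

Lemma is_diff_c_xdot z : is_diff z (@c_xdot R) (@c_xdot R).
Proof. by apply: is_diff_snd; apply: is_diff_fst; exact: is_diff_id. Qed.

Lemma is_diff_p_t z : is_diff z (@p_t R) (@p_t R).
Proof. by do 2! apply: is_diff_fst; apply: is_diff_snd; exact: is_diff_id. Qed.

Lemma is_diff_p_x z : is_diff z (@p_x R) (@p_x R).
Proof.
by apply: is_diff_snd; apply: is_diff_fst; apply: is_diff_snd; exact: is_diff_id.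
Qed.

Lemma is_diff_p_xdot z : is_diff z (@p_xdot R) (@p_xdot R).
Proof. by do 2! apply: is_diff_snd; exact: is_diff_id. Qed.

Lemma is_diff_xdot_momentum z :
  is_diff z (@xdot_momentum R)
    (fun w => pairing (p_xdot w) (c_xdot z) + pairing (p_xdot z) (c_xdot w)).
Proof. exact: is_diff_pairing (is_diff_p_xdot z) (is_diff_c_xdot z). Qed.

Lemma pairingZl a (u v : 'rV[R]_3) : pairing (a *: u) v = a * pairing u v.
Proof. by rewrite /pairing mulr_sumr; apply: eq_bigr => i _; rewrite mxE mulrA. Qed.

Lemma pairingZr a (u v : 'rV[R]_3) : pairing u (a *: v) = a * pairing u v.
Proof. by rewrite /pairing mulr_sumr; apply: eq_bigr => i _; rewrite mxE mulrCA. Qed.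

Lemma pairing0l (v : 'rV[R]_3) : pairing 0 v = 0.
Proof. by rewrite -(scale0r 0) pairingZl mul0r. Qed.

Lemma pairing0r (v : 'rV[R]_3) : pairing v 0 = 0.
Proof. by rewrite -(scale0r 0) pairingZr mul0r. Qed.

Lemma pairing_self_gt0 (v : 'rV[R]_3) : v != 0 -> 0 < pairing v v.
Proof.
move=> v0; rewrite lt_neqAle sumr_ge0 ?andbT => [|i _]; last first.
  by rewrite -expr2 sqr_ge0.
apply: contra v0; rewrite eq_sym psumr_eq0 => [/allP v0|i _]; last first.
  by rewrite -expr2 sqr_ge0.
apply/eqP/rowP => i; rewrite mxE.
by have := v0 i (mem_index_enum i); rewrite /= mulf_eq0 orbb => /eqP.
Qed.

(** The common form of the vectors spanned by X_{p_t} and X_{<p_xdot, xdot>}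
    (g = 0) and of the values of X_{J_tau} (g is the component along p_t). *)
Definition leaf_velocity (a b g : R) z : phase R :=
  ((a, 0, b *: c_xdot z), (g, 0, - (b *: p_xdot z))).

Variables (a b : R) (c : R -> phase R) (al be ga : R -> R).
Hypothesis c_TJ01 : forall r, a < r < b -> TJ01 (c r).
Hypothesis c_velocity : forall r, a < r < b ->
  is_derive r (1 : R) c (leaf_velocity (al r) (be r) (ga r) (c r)).

Lemma is_derive_comp_curve (W : normedModType R) (f df : phase R -> W) (r : R) :
  a < r < b -> is_diff (c r) f df ->
  is_derive r (1 : R) (fun s => f (c s))
    (df (leaf_velocity (al r) (be r) (ga r) (c r))).
Proof.
move=> rab fd.
have cd := is_derive1_is_diff (c_velocity rab).
have fcd : is_diff r (f \o c) _ := is_diff_comp cd fd.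
by have := is_diff_is_derive (1 : R) fcd; rewrite /= scale1r.
Qed.

(** The primitive of be is ln |xdot|, written ln (|xdot|^2) / 2 to remain
    differentiable without square roots; it is defined since xdot never
    vanishes on phase space. *)
Lemma half_log_norm :
  exists l : R -> R, forall r, a < r < b -> is_derive r (1 : R) l (be r).
Proof.
exists (2^-1 *: (@ln R \o fun r => pairing (c_xdot (c r)) (c_xdot (c r)))).
move=> r rab.
have N0 := pairing_self_gt0 (c_TJ01 rab).
have Nd := is_derive_comp_curve rab
  (is_diff_pairing (is_diff_c_xdot (c r)) (is_diff_c_xdot (c r))).
have lnNd := is_derive1_comp (is_derive1_ln N0) Nd.
apply: is_derive_eq (is_deriveZ 2^-1 lnNd) _.
rewrite /leaf_velocity /c_xdot /= pairingZl pairingZr -/(c_xdot _).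
by rewrite /GRing.scale /=; field; rewrite gt_eqF.
Qed.

Lemma p_t_constant : (forall r, a < r < b -> ga r = 0) ->
  forall r1 r2, a < r1 < b -> a < r2 < b -> p_t (c r1) = p_t (c r2).
Proof.
move=> ga0; apply: (@is_derive_0_itvoo _ a b (fun r => p_t (c r))) => r rab.
by have := is_derive_comp_curve rab (is_diff_p_t (c r)); rewrite /p_t /= ga0.
Qed.

(** xdot and p_xdot are rescaled at opposite rates. *)
Lemma xdot_momentum_constant r1 r2 : a < r1 < b -> a < r2 < b ->
  xdot_momentum (c r1) = xdot_momentum (c r2).
Proof.
apply: (@is_derive_0_itvoo _ a b (fun r => xdot_momentum (c r))) => r rab.
have := is_derive_comp_curve rab (is_diff_xdot_momentum (c r)).
rewrite /p_xdot /c_xdot /= -scaleNr pairingZl pairingZr.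
by rewrite mulNr addNr.
Qed.

(** Here p_t solves the same linear equation as the entries of xdot. *)
Lemma p_t_stays_zero : (forall r, a < r < b -> ga r = be r * p_t (c r)) ->
  forall r1 r2, a < r1 < b -> a < r2 < b -> p_t (c r1) = 0 -> p_t (c r2) = 0.
Proof.
move=> gaE r1 r2 r1ab r2ab p0; have [l ld] := half_log_norm.
rewrite (@linear_ode_expR _ a b 1 (fun r => p_t (c r)) l be _ _ r1 r2) //.
  by rewrite p0 mulr0.
move=> r rab; rewrite mul1r -gaE //.
exact: is_derive_comp_curve rab (is_diff_p_t (c r)).
Qed.

(** With l the primitive of be, e^{-l} xdot and e^{l} p_xdot are constant, so
    s = l r2 - l r1 is the parameter of [c r2] in the leaf of [c r1]. *)
Lemma leaf_curve_in_O_ r1 r2 : a < r1 < b -> a < r2 < b ->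
  p_t (c r1) = p_t (c r2) -> O_ (c r1) (c r2).
Proof.
move=> r1ab r2ab pt12; have [l ld] := half_log_norm.
exists (c_t (c r2)), (l r2 - l r1); rewrite pt12.
have x12 : c_x (c r1) = c_x (c r2).
  apply/rowP => i.
  apply: (@is_derive_0_itvoo _ a b (fun r => c_x (c r) 0 i)) => // r rab.
  have := is_derive_comp_curve rab (is_diff_entry 0 i (is_diff_c_x (c r))).
  by rewrite /= mxE.
have px12 : p_x (c r1) = p_x (c r2).
  apply/rowP => i.
  apply: (@is_derive_0_itvoo _ a b (fun r => p_x (c r) 0 i)) => // r rab.
  have := is_derive_comp_curve rab (is_diff_entry 0 i (is_diff_p_x (c r))).
  by rewrite /= mxE.
have xd12 : c_xdot (c r2) = expR (l r2 - l r1) *: c_xdot (c r1).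
  apply/rowP => i; rewrite mxE.
  rewrite (@linear_ode_expR _ a b 1 (fun r => c_xdot (c r) 0 i) l be _ _ r1 r2)
    ?mul1r // => r rab.
  have := is_derive_comp_curve rab (is_diff_entry 0 i (is_diff_c_xdot (c r))).
  by rewrite /= mxE mul1r.
have pd12 : p_xdot (c r2) = expR (- (l r2 - l r1)) *: p_xdot (c r1).
  apply/rowP => i; rewrite mxE -mulN1r.
  rewrite (@linear_ode_expR _ a b (-1) (fun r => p_xdot (c r) 0 i) l be _ _
    r1 r2) // => r rab.
  have := is_derive_comp_curve rab (is_diff_entry 0 i (is_diff_p_xdot (c r))).
  by rewrite /= !mxE mulN1r mulNr.
rewrite x12 px12 -xd12 -pd12.
by case: (c r2) => [[[? ?] ?] [[? ?] ?]].
Qed.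
End phase_curves.

(** * Hamiltonian vector fields *)

Section hamiltonian_vector_fields.
Variable R : realType.
Implicit Types (z w X : phase R).

Lemma pairing_delta (u : 'rV[R]_3) i : pairing u (delta_mx 0 i) = u 0 i.
Proof.
rewrite /pairing (bigD1 i) //= mxE !eqxx mulr1 big1 ?addr0 // => j /negbTE ji.
by rewrite mxE ji andbF mulr0.
Qed.

Lemma pairingC (u v : 'rV[R]_3) : pairing u v = pairing v u.
Proof. by apply: eq_bigr => i _; rewrite mulrC. Qed.

(** Pairing with each canonical basis vector isolates one component of X, up to
    sign. *)
Lemma omega_nondegenerate X Y : (forall w, omega X w = omega Y w) -> X = Y.
Proof.
rewrite /omega /c_t /c_x /c_xdot /p_t /p_x /p_xdot.
case: X Y => [[[a b] c] [[d e] f]] [[[a' b'] c'] [[d' e'] f']] /= E.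
pose simp0 := (mulr0, mul0r, mulr1, mul1r, oppr0, addr0, add0r, subr0, sub0r).
have a12 : a = a'.
  have := E ((0, 0, 0), (1, 0, 0)); rewrite /= !pairing0l !pairing0r.
  by rewrite !simp0 => /oppr_inj.
have d12 : d = d'.
  have := E ((1, 0, 0), (0, 0, 0)); rewrite /= !pairing0l !pairing0r.
  by rewrite !simp0.
have b12 : b = b'.
  apply/rowP => i; have := E ((0, 0, 0), (0, delta_mx 0 i, 0)).
  rewrite /= !pairing0l !pairing0r !(pairingC (delta_mx _ _)) !pairing_delta.
  by rewrite !simp0 => /oppr_inj.
have e12 : e = e'.
  apply/rowP => i; have := E ((0, delta_mx 0 i, 0), (0, 0, 0)).
  rewrite /= !pairing0l !pairing0r !pairing_delta.
  by rewrite !simp0.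
have c12 : c = c'.
  apply/rowP => i; have := E ((0, 0, 0), (0, 0, delta_mx 0 i)).
  rewrite /= !pairing0l !pairing0r !(pairingC (delta_mx _ _)) !pairing_delta.
  by rewrite !simp0 => /oppr_inj.
have f12 : f = f'.
  apply/rowP => i; have := E ((0, 0, delta_mx 0 i), (0, 0, 0)).
  rewrite /= !pairing0l !pairing0r !pairing_delta.
  by rewrite !simp0.
by rewrite a12 b12 c12 d12 e12 f12.
Qed.

(** Exhibiting one solution of the defining equation suffices, by
    nondegeneracy of omega. *)
Lemma hamiltonian_vfE (f df : phase R -> R) z X : is_diff z f df ->
  (forall w, omega X w = - df w) -> hamiltonian_vf f z = X.
Proof.
move=> fd XE; have dfE w : 'd f z w = df w by rewrite diff_val.
apply: xget_unique => [w|Y YE]; first by rewrite dfE XE.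
by apply: omega_nondegenerate => w; rewrite YE dfE XE.
Qed.

Lemma hamiltonian_vf_p_t z : hamiltonian_vf (@p_t R) z = leaf_velocity 1 0 0 z.
Proof.
apply: (hamiltonian_vfE (is_diff_p_t z)) => w.
rewrite /omega /leaf_velocity /c_t /c_x /c_xdot /p_t /p_x /p_xdot /= !scale0r oppr0.
by rewrite !pairing0l !pairing0r mulr1 mul0r !subr0 !addr0 sub0r.
Qed.

Lemma hamiltonian_vf_xdot_momentum z :
  hamiltonian_vf (@xdot_momentum R) z = leaf_velocity 0 1 0 z.
Proof.
apply: (hamiltonian_vfE (is_diff_xdot_momentum z)) => w.
rewrite /omega /leaf_velocity /c_t /c_x /c_xdot /p_t /p_x /p_xdot /=.
by rewrite -(scaleNr 1 z.2.2) pairingZl pairingZr !pairing0l !pairing0r; ring.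
Qed.

Lemma hamiltonian_vf_J_ (tau : R -> R) z : smooth_on setT tau ->
  hamiltonian_vf (J_ tau) z =
  leaf_velocity (tau (c_t z)) (- derive1 tau (c_t z))
    (derive1n 2 tau (c_t z) * xdot_momentum z - derive1 tau (c_t z) * p_t z) z.
Proof.
move=> tau_smooth.
have taud r : is_derive r (1 : R) tau (derive1 tau r).
  rewrite derive1E; apply: derivableP.
  by have [_ /(_ 1)] := tau_smooth [::] r I.
have dtaud r : is_derive r (1 : R) (derive1 tau) (derive1n 2 tau r).
  rewrite derive1nS derive1n1 derive1E; apply: derivableP.
  rewrite (_ : derive1 tau = iter_derive tau [:: 1]).
    by have [_ /(_ 1)] := tau_smooth [:: 1] r I.
  by rewrite funeqE => s; rewrite derive1E.
have t1 := is_diff_comp (is_diff_c_t z) (is_derive1_is_diff (taud (c_t z))).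
have t2 := is_diff_comp (is_diff_c_t z) (is_derive1_is_diff (dtaud (c_t z))).
have d1 := is_diffM t1 (is_diff_p_t z).
have d2 := is_diffM t2 (is_diff_xdot_momentum z).
apply: (hamiltonian_vfE (is_diffB d1 d2)) => w.
rewrite /omega /leaf_velocity !fctE /c_t /c_x /c_xdot /p_t /p_x /p_xdot /=.
rewrite -(scaleNr _ z.2.2) pairingZl pairingZr !pairing0l !pairing0r /GRing.scale /=.
by rewrite -/(p_xdot z) -/(c_xdot z); ring.
Qed.

End hamiltonian_vector_fields.

(** * Smoothness *)

Section smooth_classes.
Variable R : realType.
Implicit Types (V W : normedModType R).

(** Iterated derivatives are hard to write explicitly; it is enough to find a
    family of differentiable maps that is stable under directional
    derivatives. *)
Lemma smooth_on_class V W (P : set (V -> W)) (U : set V) (f : V -> W) :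
  (forall g, P g -> forall x, differentiable g x) ->
  (forall g v, P g -> P (fun x => 'D_v g x)) ->
  P f -> smooth_on U f.
Proof.
move=> Pdiff Pder Pf vs x _.
suff Pfvs : P (iter_derive f vs).
  have fx := Pdiff _ Pfvs x.
  by split=> [|v]; [exact: differentiable_continuous | exact: diff_derivable].
by elim: vs f Pf => [|v vs IH] f Pf //=; apply/IH/Pder.
Qed.

Lemma is_diff_affine V (a : R) (b : V) x :
  is_diff x (fun y => a *: y + b) ( *:%R a).
Proof.
have sd := is_diff_scaler a x; have cd := is_diff_cst b x.
by apply: is_diff_eq (is_diffD sd cd) _; rewrite addr0.
Qed.

Lemma smooth_on_affine V (U : set V) (a : R) (b : V) :
  smooth_on U (fun y => a *: y + b).
Proof.
apply: (@smooth_on_class _ _ [set g | exists a b, g = fun y => a *: y + b]).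
- by move=> _ [c [d ->]] x; have := is_diff_affine c d x.
- move=> _ v [c [d ->]]; exists 0, (c *: v); rewrite funeqE => x.
  rewrite scale0r add0r.
  by have [_ ->] := is_diff_is_derive v (is_diff_affine c d x).
- by exists a, b.
Qed.

Lemma derive1_affine (a b t : R) : derive1 (fun y => a * y + b) t = a.
Proof.
rewrite derive1E.
have [_ ->] := is_diff_is_derive (1 : R) (is_diff_affine a b t).
exact: mulr1.
Qed.
End smooth_classes.

(** * The leaves and the two orbits *)

Section leaves.
Variable R : realType.
Implicit Types (p q z w : phase R).

(** The parametrization of [O_ q]. It makes sense for every phase vector q, also
    outside [TJ01], so that its own derivatives have the same form. *)
Definition leaf_point q (u s : R) : phase R :=
  ((u, c_x q, expR s *: c_xdot q), (p_t q, p_x q, expR (- s) *: p_xdot q)).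

Lemma leaf_point_comp q u s v r :
  leaf_point (leaf_point q u s) v r = leaf_point q v (s + r).
Proof.
by rewrite /leaf_point /c_x /c_xdot /p_t /p_x /p_xdot /= !scalerA -!expRD opprD
  [r + s]addrC [- r - s]addrC.
Qed.

Lemma leaf_point_id q : leaf_point q (c_t q) 0 = q.
Proof.
rewrite /leaf_point oppr0 expR0 !scale1r.
by case: q => [[[? ?] ?] [[? ?] ?]].
Qed.

Lemma O_refl q : O_ q q.
Proof. by exists (c_t q), 0; rewrite [RHS]leaf_point_id. Qed.

Lemma O_trans q z w : O_ q z -> O_ z w -> O_ q w.
Proof.
by move=> [u [s ->]] [v [r ->]]; exists v, (s + r); rewrite [LHS]leaf_point_comp.
Qed.

Lemma O_sym q z : O_ q z -> O_ z q.
Proof.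
move=> [u [s ->]]; exists (c_t q), (- s).
by rewrite [RHS]leaf_point_comp subrr leaf_point_id.
Qed.

Lemma xdot_momentum_leaf_point q u s :
  xdot_momentum (leaf_point q u s) = xdot_momentum q.
Proof.
rewrite /xdot_momentum /leaf_point /c_xdot /p_xdot /= pairingZl pairingZr.
by rewrite mulrA -expRD addNr expR0 mul1r.
Qed.

Lemma TJ01_leaf_point q u s : TJ01 q -> TJ01 (leaf_point q u s).
Proof. by rewrite /TJ01 /= => q0; rewrite scaler_eq0 negb_or gt_eqF ?expR_gt0. Qed.

Lemma is_diff_leaf_point (U : normedModType R) (f df g dg : U -> R) q x :
  is_diff x f df -> is_diff x g dg ->
  is_diff x (fun y => leaf_point q (f y) (g y))
    (fun h => leaf_velocity (df h) (dg h) 0 (leaf_point q (f x) (g x))).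
Proof.
move=> fd gd.
have expd (t : R) := is_derive1_is_diff (is_derive_expR t).
have gNd := is_diffN gd.
have eg := is_diff_comp gd (expd (g x)).
have egN : is_diff x (fun y => expR (- g y)) _ := is_diff_comp gNd (expd (- g x)).
have d1 := is_diff_scalel_comp (c_xdot q) eg.
have d2 := is_diff_scalel_comp (p_xdot q) egN.
have cx := is_diff_cst (c_x q) x.
have ct := is_diff_cst (p_t q) x.
have cp := is_diff_cst (p_x q) x.
have := is_diff_pair (is_diff_pair (is_diff_pair fd cx) d1)
                     (is_diff_pair (is_diff_pair ct cp) d2).
move=> H; apply: is_diff_eq H _; rewrite funeqE => h.
rewrite /leaf_velocity /leaf_point /c_xdot /p_xdot /= !scalerA.
by rewrite -scaleNr -mulNr.
Qed.

(** For tau(t) = t + b one has J_tau = (t + b) p_t - m: taking b = - t gives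
    m = 0, and then b = 1 - t gives p_t = 0. *)
Lemma J_diff_zero_levelP p : J_diff_zero_level p ->
  [/\ TJ01 p, p_t p = 0 & xdot_momentum p = 0].
Proof.
move=> [pT Jp].
have J0 b : (c_t p + b) * p_t p - xdot_momentum p = 0.
  have : J_ (fun t => 1 * t + b) p = 0.
    apply: Jp; split; first exact: smooth_on_affine.
    by move=> t; rewrite derive1_affine oner_neq0.
  by rewrite /J_ derive1_affine !mul1r.
have := J0 (- c_t p); rewrite subrr mul0r sub0r => /eqP; rewrite oppr_eq0 => /eqP m0.
split=> //.
by have := J0 (1 - c_t p); rewrite [c_t p + _]addrC subrK mul1r m0 subr0.
Qed.

(** With p_t = m = 0 the p_t component of the lifted action is trivial, so the
    action only depends on phi(t) and phi'(t), and affine maps realize every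
    value of this pair with phi'(t) > 0. *)
Lemma group_orbitE p : p_t p = 0 -> xdot_momentum p = 0 -> group_orbit p = O_ p.
Proof.
move=> pt0 m0.
have actE phi : lifted_action phi p =
    ((phi (c_t p), c_x p, (derive1 phi (c_t p))^-1 *: c_xdot p),
     (p_t p, p_x p, derive1 phi (c_t p) *: p_xdot p)).
  by rewrite /lifted_action -/(xdot_momentum p) pt0 m0 !mul0r addr0.
apply/seteqP; split=> [w [phi [_ _ dphi0] ->]|w [u [s ->]]].
  exists (phi (c_t p)), (- ln (derive1 phi (c_t p))).
  by rewrite actE opprK expRN lnK ?posrE.
have a0 := expR_gt0 (- s).
set a := expR (- s) in a0 *.
exists (fun t => a * t + (u - a * c_t p)); last first.
  by rewrite actE derive1_affine addrC subrK /a expRN invrK.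
split; first exact: smooth_on_affine.
  exists (fun t => a^-1 * t + (- (a^-1 * (u - a * c_t p)))); split.
  - by move=> t; rewrite mulrDr addrK mulrA mulVf ?mul1r ?gt_eqF.
  - by move=> t; rewrite mulrDr mulrN !mulrA divff ?gt_eqF // !mul1r subrK.
  - exact: smooth_on_affine.
by move=> t; rewrite derive1_affine.
Qed.

(** One affine field is enough when s <> 0: its flow moves t along
    (t + K) e^{- s r} - K, and K is determined by the value u required at r = 1. *)
Lemma vf_orbit_leaf_step p q u s : TJ01 q -> p_t q = 0 -> xdot_momentum q = 0 ->
  s != 0 -> algebra_orbit p q -> algebra_orbit p (leaf_point q u s).
Proof.
move=> qT pt0 m0 s0 pq.
pose e := expR (- s); have e1 : e - 1 != 0.
  rewrite subr_eq0; apply: contra s0 => /eqP e1.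
  by rewrite -oppr_eq0; apply/eqP/expR_inj; rewrite expR0.
pose K := (u - c_t q * e) / (e - 1).
pose tau := fun t : R => - s * t + (- s * K).
pose c := fun r : R => leaf_point q ((c_t q + K) * expR (- s * r) - K) (s * r).
have c0 : c 0 = q by rewrite /c !mulr0 expR0 mulr1 addrK leaf_point_id.
have c1 : c 1 = leaf_point q u s.
  rewrite /c !mulr1; congr leaf_point.
  by rewrite -/e /K; field.
rewrite -c1.
have taud : diff_plus tau.
  by split=> [|t]; [exact: smooth_on_affine | rewrite derive1_affine oppr_eq0].
apply: (@vf_orbit_step _ _ _ _ _ (hamiltonian_vf (J_ tau)) (-1) 2 0 1).
- by exists tau.
- move=> r _; split; first exact: TJ01_leaf_point.
  rewrite hamiltonian_vf_J_; last by case: taud.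
  have ptr : p_t (c r) = 0 by exact: pt0.
  rewrite xdot_momentum_leaf_point m0 ptr !mulr0 subr0 derive1_affine opprK.
  have sd k : is_diff r (fun t => k * t) _ := is_diff_scaler k r.
  have expd (t : R) := is_derive1_is_diff (is_derive_expR t).
  have ed := is_diff_comp (sd (- s)) (expd (- s * r)).
  have fd := is_diffB (is_diffZ (c_t q + K) ed) (is_diff_cst K r).
  have := is_diff_is_derive (1 : R) (is_diff_leaf_point q fd (sd s)).
  move=> H; apply: is_derive_eq H _.
  congr leaf_velocity; last exact: mulr1.
  rewrite !fctE /tau /c /leaf_point /c_t /= /GRing.scale /=.
  by rewrite [X in _ - X = _](_ : _ = 0) //; ring.
- by apply/andP; split; lra.
- by apply/andP; split; lra.
- by rewrite c0.
Qed.

Lemma algebra_orbitE p : TJ01 p -> p_t p = 0 -> xdot_momentum p = 0 ->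
  algebra_orbit p = O_ p.
Proof.
move=> pT pt0 m0; apply/seteqP; split=> [w|w [u [s ->]]].
  elim=> [_|X a b r1 r2 c [tau [tau_smooth _] ->] cX r1ab r2ab _ pc].
    exact: O_refl.
  apply: (O_trans pc).
  have m1 : xdot_momentum (c r1) = 0.
    by case: pc => v [s ->]; rewrite [LHS]xdot_momentum_leaf_point.
  have pt1 : p_t (c r1) = 0 by case: pc => v [s ->].
  have cT r : a < r < b -> TJ01 (c r) by move=> /cX[].
  (* The value of X_{J_tau} is a leaf velocity with be = - tau'; since m = 0 along
     the curve, its component along p_t is the product of be and p_t. *)
  pose al r := tau (c_t (c r)); pose be r := - derive1 tau (c_t (c r)).
  pose ga r := derive1n 2 tau (c_t (c r)) * xdot_momentum (c r)
               - derive1 tau (c_t (c r)) * p_t (c r).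
  have cd r : a < r < b ->
      is_derive r (1 : R) c (leaf_velocity (al r) (be r) (ga r) (c r)).
    by move=> /cX[_]; rewrite hamiltonian_vf_J_.
  apply: (leaf_curve_in_O_ cT cd) => //; rewrite pt1; apply/esym.
  apply: (p_t_stays_zero cT cd _ r1ab) => // r rab.
  by rewrite /ga (xdot_momentum_constant cd rab r1ab) m1 mulr0 sub0r mulNr.
have pp : algebra_orbit p p by exact: vf_orbit_refl.
rewrite -/(algebra_orbit p) -/(leaf_point p u s).
(* For s = 0, move along s = 1 and come back along s = -1. *)
have [->|s0] := eqVneq s 0; last exact: vf_orbit_leaf_step.
have <- : leaf_point (leaf_point p u 1) u (- 1) = leaf_point p u 0.
  by rewrite leaf_point_comp subrr.
apply: vf_orbit_leaf_step; rewrite ?oppr_eq0 ?oner_neq0 //.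
- exact: TJ01_leaf_point.
- by rewrite xdot_momentum_leaf_point.
- by apply: vf_orbit_leaf_step => //; rewrite oner_neq0.
Qed.

End leaves.

(** * The integral manifold *)

Section integral_manifold.
Variable R : realType.
Implicit Types (p q z w : phase R).

Definition leaf_distribution : phase R -> set (phase R) :=
  span2 (hamiltonian_vf (@p_t R)) (hamiltonian_vf (@xdot_momentum R)).

Lemma leaf_distributionE q w :
  leaf_distribution q w <-> exists a b, w = leaf_velocity a b 0 q.
Proof.
have E a b : a *: hamiltonian_vf (@p_t R) q
    + b *: hamiltonian_vf (@xdot_momentum R) q = leaf_velocity a b 0 q.
  rewrite hamiltonian_vf_p_t hamiltonian_vf_xdot_momentum /leaf_velocity.
  rewrite !scale0r !scale1r oppr0.
  apply/pair_equal_spec; split; apply/pair_equal_spec; split => /=.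
  - apply/pair_equal_spec; split; rewrite /= ?scaler0 ?addr0 //.
    by rewrite /GRing.scale /=; ring.
  - by rewrite scaler0 add0r.
  - by rewrite !scaler0 addr0.
  - by rewrite scaler0 add0r scalerN.
by split=> -[a [b ->]]; exists a, b; rewrite E.
Qed.

Section maximality.
Variables (n : nat) (c : param (phase R) n.+1).
Hypothesis c_immersive : immersive_param c.
Hypothesis c_in_TJ01 : forall u, c.1 u -> TJ01 (c.2 u).
Hypothesis c_tangent : forall u, c.1 u ->
  range ('d (c.2) u) = leaf_distribution (c.2 u).

Lemma immersive_param_differentiable u : c.1 u -> differentiable c.2 u.
Proof.
case: c_immersive => _ _ _ dinj cu; apply: contrapT => /diff_not_differentiable d0.
have := dinj u cu (const_mx 1) 0; rewrite d0 => /(_ erefl)/matrixP/(_ 0 0).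
by rewrite !mxE => /eqP; rewrite oner_eq0.
Qed.

(** The parametrization maps the segment from u0 to a nearby u to a curve tangent
    to the distribution. Such a curve keeps p_t fixed, so it stays in one leaf.
    The coefficients of its velocity are picked pointwise. *)
Lemma tangent_param_locally_in_O_ u0 : c.1 u0 ->
  \forall u \near u0, c.1 u /\ O_ (c.2 u0) (c.2 u).
Proof.
have [cO _ _ _] := c_immersive.
move=> cu0; have /nbhs_ballP[e /= e0 ec] : nbhs u0 c.1 by exact: open_nbhs_nbhs.
apply/nbhs_ballP; exists (e / 2) => /= [|u u0u]; first by rewrite divr_gt0.
pose h := u - u0.
(* The segment is prolonged beyond r = 0 and r = 1 to have two-sided derivatives
   there; this is why u is taken within e / 2 of u0. *)
have seg (r : R) : -2 < r < 2 -> c.1 (u0 + r *: h).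
  move=> r2; apply: ec; rewrite -ball_normE /= opprD addNKr normrN normrZ.
  have hlt : `|h| < e / 2 by move: u0u; rewrite -ball_normE /= distrC.
  have rlt : `|r| < 2 by rewrite ltr_norml.
  rewrite (_ : e = 2 * (e / 2)); last by field.
  by rewrite ltr_pM.
have vel (r : R) : exists ab : R * R, -2 < r < 2 ->
    is_derive r (1 : R) (fun s => c.2 (u0 + s *: h))
      (leaf_velocity ab.1 ab.2 0 (c.2 (u0 + r *: h))).
  have [/seg cr|nr] := pselect (-2 < r < 2); last by exists (0, 0) => /nr.
  have cd := immersive_param_differentiable cr.
  have : leaf_distribution (c.2 (u0 + r *: h)) ('d (c.2) (u0 + r *: h) h).
    by rewrite -c_tangent //; exists h.
  move=> /leaf_distributionE[a [b E]]; exists (a, b) => _ /=.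
  apply: is_derive_line; rewrite -E.
  by apply: is_diff_is_derive; exact/differentiableP.
have [ab abP] := choice vel.
have cT (r : R) : -2 < r < 2 -> TJ01 (c.2 (u0 + r *: h)) by move=> /seg/c_in_TJ01.
have r0 : -2 < (0 : R) < 2 by apply/andP; split; lra.
have r1 : -2 < (1 : R) < 2 by apply/andP; split; lra.
have pt01 := p_t_constant abP (fun _ _ => erefl) r0 r1.
have := leaf_curve_in_O_ cT abP r0 r1 pt01.
have := seg 1 r1.
by rewrite scale0r addr0 scale1r /h [u0 + _]addrC subrK.
Qed.

Lemma open_preimage_O_ p : open (c.1 `&` c.2 @^-1` O_ p).
Proof.
rewrite openE => u [cu pu]; rewrite /interior.
apply: filterS (tangent_param_locally_in_O_ cu) => v [cv uv].
by split => //; exact: O_trans pu uv.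
Qed.

Lemma open_preimage_notO_ p : open (c.1 `&` c.2 @^-1` (~` O_ p)).
Proof.
rewrite openE => u [cu pu]; rewrite /interior.
apply: filterS (tangent_param_locally_in_O_ cu) => v [cv uv].
by split => // pv; apply: pu; exact: O_trans pv (O_sym uv).
Qed.
End maximality.

(** Both [O_ p] and its complement pull back to open sets in every chart of N. *)
Lemma integral_manifold_sub_O_ n p (N : set (phase R)) :
  connected_integral_manifold n.+1 (@TJ01 R) leaf_distribution N ->
  N p -> N `<=` O_ p.
Proof.
move=> [NT [A [[_ NE Aimm _] Aconn AD]]] Np.
have AN c u : A c -> c.1 u -> N (c.2 u).
  by move=> Ac cu; rewrite NE; exists c => //; exists u.
suff <- : N `&` O_ p = N by apply: subIsetr.
apply: Aconn.
- exact: subIsetl.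
- by exists p; split => //; exact: O_refl.
- move=> c Ac.
  have := open_preimage_O_ (c := c) (Aimm c Ac)
    (fun u cu => NT _ (AN c u Ac cu)) (AD c ^~ Ac) (p := p).
  congr open; apply/seteqP; split=> u [cu pu]; split=> //.
    by split => //; exact: AN.
  by case: pu.
- move=> c Ac.
  have := open_preimage_notO_ (c := c) (Aimm c Ac)
    (fun u cu => NT _ (AN c u Ac cu)) (AD c ^~ Ac) (p := p).
  congr open; apply/seteqP; split=> u [cu pu]; split=> //.
    by split => [|[]//]; exact: AN.
  by move=> pu'; case: pu => Nu; apply; split.
Qed.

Definition leaf_chart p (y : 'rV[R]_2) : phase R := leaf_point p (y 0 0) (y 0 1).

Lemma leaf_chart_image p : range (leaf_chart p) = O_ p.
Proof.
apply/seteqP; split=> [_ [y _ <-]|_ [u [s ->]]]; first by exists (y 0 0), (y 0 1).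
exists (\row_i if i == 0 then u else s) => //.
by rewrite /leaf_chart !mxE.
Qed.

Lemma rV2_eq (y y' : 'rV[R]_2) : y 0 0 = y' 0 0 -> y 0 1 = y' 0 1 -> y = y'.
Proof.
move=> y0 y1; apply/rowP => i.
by have [->|->] : i = 0 \/ i = 1;
  [case: i => [[|[|//]] ?]; [left|right]; exact: val_inj|..].
Qed.

Lemma leaf_chart_inj p : TJ01 p -> injective (leaf_chart p).
Proof.
move=> pT y y' [y0 /eqP + _].
rewrite -subr_eq0 -scalerBl scaler_eq0 (negbTE pT) orbF subr_eq0.
move=> /eqP/expR_inj y1; exact: rV2_eq.
Qed.

Lemma is_diff_leaf_chart p y : is_diff y (leaf_chart p)
  (fun h => leaf_velocity (h 0 0) (h 0 1) 0 (leaf_chart p y)).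
Proof.
by apply: is_diff_leaf_point; exact: is_diff_entry (is_diff_id y).
Qed.

(** The maps (y0, y1) |-> leaf_point q (a y0 + b) y1, for all a, b and phase
    vectors q, form a family stable under directional derivatives: deriving
    along h multiplies the factors e^{y1} and e^{- y1} by h1 and - h1, which is
    absorbed in q. *)
Lemma smooth_on_leaf_chart p U : smooth_on U (leaf_chart p).
Proof.
have gd a b q y : is_diff y
    (fun y : 'rV[R]_2 => leaf_point q (a * y 0 0 + b) (y 0 1))
    (fun h => leaf_velocity (a * h 0 0) (h 0 1) 0
                (leaf_point q (a * y 0 0 + b) (y 0 1))).
  apply: is_diff_leaf_point; last exact: is_diff_entry (is_diff_id y).
  exact: is_diff_comp (is_diff_entry 0 0 (is_diff_id y)) (is_diff_affine a b _).
apply: (@smooth_on_class _ _ _ [set g | exists (a b : R) (q : phase R),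
  g = fun y : 'rV[R]_2 => leaf_point q (a * y 0 0 + b) (y 0 1)]).
- by move=> _ [a [b [q ->]]] y; have := gd a b q y.
- move=> _ h [a [b [q ->]]].
  exists 0, (a * h 0 0), ((0, 0, h 0 1 *: c_xdot q), (0, 0, - h 0 1 *: p_xdot q)).
  rewrite funeqE => y.
  have [_ ->] := is_diff_is_derive h (gd a b q y).
  rewrite /leaf_velocity /leaf_point /c_x /c_xdot /p_t /p_x /p_xdot /= mul0r add0r.
  by rewrite -scaleNr !scalerA [expR _ * h 0 1]mulrC [expR _ * - h 0 1]mulrC.
- exists 1, 0, p; rewrite funeqE => y.
  by rewrite mul1r addr0.
Qed.

Lemma leaf_chart_tangent p y :
  range ('d (leaf_chart p) y) = leaf_distribution (leaf_chart p y).
Proof.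
have cd := is_diff_leaf_chart p y.
apply/seteqP; split=> [_ [h _ <-]|w /leaf_distributionE[a [b ->]]].
  by apply/leaf_distributionE; exists (h 0 0), (h 0 1); rewrite diff_val.
by exists (\row_i if i == 0 then a else b) => //; rewrite diff_val !mxE.
Qed.

Lemma leaf_chart_immersive p : TJ01 p -> immersive_param (setT, leaf_chart p).
Proof.
move=> pT; split => /=.
- exact: openT.
- exact: smooth_on_leaf_chart.
- by move=> y y' _ _; exact: leaf_chart_inj.
move=> y _ h h'; have cd := is_diff_leaf_chart p y.
rewrite diff_val => -[h0 /eqP + _].
have /negbTE xd0 := TJ01_leaf_point (y 0 0) (y 0 1) pT.
rewrite -subr_eq0 -scalerBl scaler_eq0 xd0 orbF subr_eq0 => /eqP.
exact: rV2_eq.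
Qed.

(** Restriction to the line through a point of B and any other point reduces the
    claim to the connectedness of the real line. *)
Lemma clopen_rV n (B : set 'rV[R]_n) :
  B !=set0 -> open B -> open (~` B) -> B = setT.
Proof.
move=> [b Bb] Bo nBo; apply/seteqP; split=> // y _.
pose g (r : R) := b + r *: (y - b).
have gc : continuous g.
  by move=> r; apply: cvgD; [exact: cvg_cst | exact: scalel_continuous].
have Rc : connected [set: R] by apply/connected_intervalP.
have gBT : g @^-1` B = setT.
  apply: Rc.
  - by exists 0; rewrite /= /g scale0r addr0.
  - by exists (g @^-1` B); rewrite ?setTI //; apply: open_comp => // r _; exact: gc.
  - exists (g @^-1` B); rewrite ?setTI // -openC.
    by apply: (@open_comp _ _ g (~` B)) => // r _; exact: gc.
have : (g @^-1` B) 1 by rewrite gBT.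
by rewrite /= /g scale1r addrC subrK.
Qed.

Lemma O_connected_integral_manifold p : TJ01 p ->
  connected_integral_manifold 2 (@TJ01 R) leaf_distribution (O_ p).
Proof.
move=> pT; split=> [w [u [s ->]]|]; first exact: TJ01_leaf_point.
have chartO y : O_ p (leaf_chart p y) by exists (y 0 0), (y 0 1).
exists [set (setT, leaf_chart p)]; split; last first.
- by move=> _ y -> _; exact: leaf_chart_tangent.
- move=> B BO [b Bb] /(_ _ erefl) /=; rewrite setTI => B1 /(_ _ erefl) /=.
  rewrite setTI => B2.
  have : leaf_chart p @^-1` B = setT.
    apply: clopen_rV => //.
      have := BO _ Bb; rewrite -leaf_chart_image => -[y _ yb].
      by exists y; rewrite /= yb.
    move: B2; congr open; apply/seteqP; split=> y /=; first by case.
    by split.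
  move=> BT; apply/seteqP; split=> // w; rewrite -leaf_chart_image => -[y _ <-].
  by have : (leaf_chart p @^-1` B) y by rewrite BT.
split.
- exact: countable1.
- by rewrite bigcup_set1 leaf_chart_image.
- by move=> _ ->; exact: leaf_chart_immersive.
- move=> _ _ -> ->; rewrite /compatible_params.
  have -> : overlap (setT, leaf_chart p) (setT, leaf_chart p) = setT.
    by apply/seteqP; split=> // y _; split => //=; exists y.
  split; first exact: openT.
  exists id; split=> //.
  rewrite (_ : id = fun y => 1 *: y + 0); first exact: smooth_on_affine.
  by rewrite funeqE => y; rewrite scale1r addr0.
Qed.
End integral_manifold.

Theorem theorem4p4 (R : realType) (p : phase R) :
  J_diff_zero_level p ->
  [/\ p_t p = 0,
      algebra_orbit p = O_ p,
      group_orbit p = O_ p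
    & maximal_integral_manifold 2 (@TJ01 R)
        (span2 (hamiltonian_vf (@p_t R)) (hamiltonian_vf (@xdot_momentum R)))
        p (O_ p)].
Proof.
move=> /J_diff_zero_levelP[pT pt0 m0]; split=> //.
- exact: algebra_orbitE.
- exact: group_orbitE.
split; first exact: O_connected_integral_manifold.
- exact: O_refl.
- by move=> N; exact: integral_manifold_sub_O_.
Qed.
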